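(* Let $F,f\colon\mathbb R^n\times\mathbb R^m\to\mathbb R$, $G\colon\mathbb R^n\times\mathbb R^m\to\mathbb R^s$, and $g\colon\mathbb R^n\times\mathbb R^m\to\mathbb R^t$ be twice continuously differentiable and let $\lambda>0$ be given. Let $(w,\xi)=((x,y),(\mu,\nu,\hat\nu))\in\mathbb R^{n+m}\times\mathbb R^{s+2t}$ be a solution of the stationarity system $$\begin{aligned}&\nabla F(x,y)+G'(x,y)^\top\mu+g'(x,y)^\top(\nu-\lambda\hat\nu)=0,\qquad \nabla_yf(x,y)+g'_y(x,y)^\top\hat\nu=0,\\ &\mu\ge0,\ G(x,y)\le0,\ \mu^\top G(x,y)=0,\\ &\nu\ge0,\ g(x,y)\le0,\ \nu^\top g(x,y)=0,\\ &\hat\nu\ge0,\ g(x,y)\le 0,\ \hat\nu^\top g(x,y)=0.\end{aligned}$$ Let LLICQ and BLICQ be satisfied at $(x,y)$, and assume that the second-order condition $$\forall\,\delta w\in\mathcal C(w,\xi)\setminus\{0\}\colon\quad \delta w^\top\nabla^2_{ww}L^{\mathrm{op}}_\lambda(w,\xi)\,\delta w>0$$ holds. Define $$\mathcal G(w,\xi):=\begin{bmatrix}G(x,y)\\ g(x,y)\\ g(x,y)\end{bmatrix},\qquad \mathcal H(w,\xi):=\begin{bmatrix}\nabla_wL^{\mathrm{op}}_\lambda(w,\xi)\\ \nabla_y\ell^{\mathrm{op}}(w,\xi)\end{bmatrix},\qquad p_2:=s+2t.$$ Then $(w,\xi)$ is a solution of $\mathcal H(w,\xi)=0$, $\mathcal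 G(w,\xi)\le0$, $\xi\ge0$, $\mathcal G(w,\xi)^\top\xi=0$, and for each index set $I\subset I^{00}(w,\xi)$, with $I_{\mathrm c}:=I^{00}(w,\xi)\setminus I$, the matrix $$\begin{bmatrix}\mathcal H'_w(w,\xi)&\mathcal H'_\xi(w,\xi)\\ \mathcal G'_w(w,\xi)_{I^+(w,\xi)\cup I}&\mathcal G'_\xi(w,\xi)_{I^+(w,\xi)\cup I}\\ \mathbb O&-\mathbb I^{p_2}_{I^-(w,\xi)\cup I_{\mathrm c}}\end{bmatrix}$$ possesses linearly independent columns.
   Context: For $w=(x,y)\in\mathbb R^{n+m}$ and $\xi=(\mu,\nu,\hat\nu)\in\mathbb R^{s}\times\mathbb R^t\times\mathbb R^t$, $$L^{\mathrm{op}}_\lambda(w,\xi):=F(x,y)+\mu^\top G(x,y)+(\nu-\lambda\hat\nu)^\top g(x,y),\qquad \ell^{\mathrm{op}}(w,\xi):=f(x,y)+\hat\nu^\top g(x,y).$$ Let $I^0_G(x,y):=\{i\mid G_i(x,y)=0\}$, $I^+_G(x,y,\mu):=\{i\in I^0_G(x,y)\mid\mu_i>0\}$, $I^0_g(x,y):=\{i\mid g_i(x,y)=0\}$, and for $\eta\in\mathbb R^t$ (used with $\eta=\nu$ and $\eta=\hat\nu$) $I^+_g(x,y,\eta):=\{i\in I^0_g(x,y)\mid\eta_i>0\}$. The critical subspace is $$\mathcal C(w,\xi):=\{\delta w\in\mathbb R^{n+m}\mid G_i'(x,y)\delta w=0\ (i\in I^+_G(x,y,\mu)),\ g_i'(x,y)\delta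 w=0\ (i\in I^+_g(x,y,\nu)\cup I^+_g(x,y,\hat\nu))\}.$$ LLICQ at $(x,y)$: the gradients $\nabla_yg_i(x,y)$, $i\in I^0_g(x,y)$, are linearly independent. BLICQ at $(x,y)$: the gradients $\nabla G_i(x,y)$ ($i\in I^0_G(x,y)$) together with $\nabla g_i(x,y)$ ($i\in I^0_g(x,y)$) (full gradients with respect to $(x,y)$) are linearly independent. For the mapping $\mathcal G$ with components $\mathcal G_i$, $i\in\{1,\dots,p_2\}$: $I^-(w,\xi):=\{i\mid\mathcal G_i(w,\xi)<0\}$, $I^+(w,\xi):=\{i\mid\mathcal G_i(w,\xi)=0,\ \xi_i>0\}$, $I^{00}(w,\xi):=\{i\mid\mathcal G_i(w,\xi)=0,\ \xi_i=0\}$. For a matrix $A$, $A_I$ consists of the rows of $A$ with index in $I$; $\mathbb I^{p_2}$ is the identity matrix, $\mathbb O$ a zero matrix; subscripts $w,\xi$ on Jacobians denote partial Jacobians. *)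

(* Defs.v *)
From HB Require Import structures.
From mathcomp Require Import all_boot all_order all_algebra.
From mathcomp Require Import all_classical all_reals all_analysis.

Set Implicit Arguments.
Unset Strict Implicit.
Unset Printing Implicit Defensive.

Import Order.TTheory GRing.Theory Num.Theory.
Import numFieldNormedType.Exports.

Local Open Scope ring_scope.

(* Vectors of R^k are row vectors 'rV[R]_k.  A pair w = (x, y) of R^(n+m) is
   row_mx x y, and xi = (mu, nu, nuh) is row_mx mu (row_mx nu nuh). *)

Section Calculus.
Variable R : realType.
Implicit Types k l n m : nat.

(* [jacobian] acts on row vectors from the right; its transpose is the textbook
   Jacobian matrix, with entry (i, j) the j-th partial derivative of the i-th
   component. *)
Definition Jac k l (h : 'rV[R]_k -> 'rV[R]_l) (a : 'rV[R]_k) : 'M[R]_(l, k) :=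
  (jacobian h a)^T.

Definition gradient k (h : 'rV[R]_k -> R) (a : 'rV[R]_k) : 'rV[R]_k :=
  \row_j 'D_(delta_mx 0 j) h a.

Definition hessian k (h : 'rV[R]_k -> R) (a : 'rV[R]_k) : 'M[R]_k :=
  Jac (gradient h) a.

Definition component k l (h : 'rV[R]_k -> 'rV[R]_l) (i : 'I_l) : 'rV[R]_k -> R :=
  fun a => h a 0 i.

Definition C1 k l (h : 'rV[R]_k -> 'rV[R]_l) : Prop :=
  (forall a, differentiable h a) /\ continuous (Jac h).

Definition C2 k (h : 'rV[R]_k -> R) : Prop :=
  (forall a, differentiable h a) /\ C1 (gradient h).

Definition C2_vec k l (h : 'rV[R]_k -> 'rV[R]_l) : Prop :=
  forall i, C2 (component h i).

Definition gradient_y n m (h : 'rV[R]_(n + m) -> R) (w : 'rV[R]_(n + m)) :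
    'rV[R]_m :=
  gradient (fun y => h (row_mx (lsubmx w) y)) (rsubmx w).

Definition Jac_y n m l (h : 'rV[R]_(n + m) -> 'rV[R]_l) (w : 'rV[R]_(n + m)) :
    'M[R]_(l, m) :=
  Jac (fun y => h (row_mx (lsubmx w) y)) (rsubmx w).

Definition dot k (u v : 'rV[R]_k) : R := (u *m v^T) 0 0.

(* The submatrix of the rows of A with index in I. *)
Definition rows p q (I : {set 'I_p}) (A : 'M[R]_(p, q)) : 'M[R]_(#|I|, q) :=
  rowsub (fun k : 'I_#|I| => enum_val k) A.

Definition independent_columns p q (A : 'M[R]_(p, q)) : bool :=
  free [seq col j A | j <- enum 'I_q].

End Calculus.

Section Bilevel.
Variables (R : realType) (n m s t : nat).
Implicit Types (F f : 'rV[R]_(n + m) -> R).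
Implicit Types (G : 'rV[R]_(n + m) -> 'rV[R]_s).
Implicit Types (g : 'rV[R]_(n + m) -> 'rV[R]_t).
Implicit Types (w : 'rV[R]_(n + m)) (xi : 'rV[R]_(s + (t + t))).

Definition mu_of xi : 'rV[R]_s := lsubmx xi.
Definition nu_of xi : 'rV[R]_t := lsubmx (rsubmx xi).
Definition nuh_of xi : 'rV[R]_t := rsubmx (rsubmx xi).

Definition Lop F G g (lambda : R) w xi : R :=
  F w + dot (mu_of xi) (G w) + dot (nu_of xi - lambda *: nuh_of xi) (g w).

Definition lop f g w xi : R := f w + dot (nuh_of xi) (g w).

Definition complementary k (eta c : 'rV[R]_k) : Prop :=
  [/\ forall i, 0 <= eta 0 i, forall i, c 0 i <= 0 & dot eta c = 0].

(* Transposed relative to the usual column-vector form: mu *m Jac G w is the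
   row vector of G'(w)^T mu. *)
Definition stationary F f G g (lambda : R) w xi : Prop :=
  [/\ gradient F w + mu_of xi *m Jac G w
        + (nu_of xi - lambda *: nuh_of xi) *m Jac g w = 0,
      gradient_y f w + nuh_of xi *m Jac_y g w = 0,
      complementary (mu_of xi) (G w),
      complementary (nu_of xi) (g w) &
      complementary (nuh_of xi) (g w)].

Definition active l (h : 'rV[R]_(n + m) -> 'rV[R]_l) w : {set 'I_l} :=
  [set i | h w 0 i == 0].

Definition active_pos l (h : 'rV[R]_(n + m) -> 'rV[R]_l) w (eta : 'rV[R]_l) :
    {set 'I_l} :=
  [set i in active h w | 0 < eta 0 i].

Definition critical_subspace G g w xi : set 'rV[R]_(n + m) :=
  fun dw =>
    (forall i, i \in active_pos G w (mu_of xi) ->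
       row i (Jac G w) *m dw^T = 0) /\
    (forall i, i \in active_pos g w (nu_of xi) :|: active_pos g w (nuh_of xi) ->
       row i (Jac g w) *m dw^T = 0).

Definition LLICQ g w : bool :=
  free [seq gradient_y (component g i) w | i <- enum (active g w)].

Definition BLICQ G g w : bool :=
  free ([seq gradient (component G i) w | i <- enum (active G w)] ++
        [seq gradient (component g i) w | i <- enum (active g w)]).

Definition second_order_condition F G g (lambda : R) w xi : Prop :=
  forall dw, critical_subspace G g w xi dw -> dw != 0 ->
    0 < dot (dw *m hessian (fun w' => Lop F G g lambda w' xi) w) dw.

Definition calG G g w xi : 'rV[R]_(s + (t + t)) :=
  row_mx (G w) (row_mx (g w) (g w)).

Definition calH F f G g (lambda : R) w xi : 'rV[R]_((n + m) + m) :=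
  row_mx (gradient (fun w' => Lop F G g lambda w' xi) w)
         (gradient_y (fun w' => lop f g w' xi) w).

End Bilevel.

Section MixedComplementarity.
Variables (R : realType) (p1 p2 q : nat).
Variable (calG : 'rV[R]_p1 -> 'rV[R]_p2 -> 'rV[R]_p2).
Variable (calH : 'rV[R]_p1 -> 'rV[R]_p2 -> 'rV[R]_q).
Implicit Types (w : 'rV[R]_p1) (xi : 'rV[R]_p2).

Definition mcs_solution w xi : Prop :=
  [/\ calH w xi = 0,
      forall i, calG w xi 0 i <= 0,
      forall i, 0 <= xi 0 i &
      dot (calG w xi) xi = 0].

Definition Iminus w xi : {set 'I_p2} := [set i | calG w xi 0 i < 0].

Definition Iplus w xi : {set 'I_p2} :=
  [set i | (calG w xi 0 i == 0) && (0 < xi 0 i)].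

Definition Izero w xi : {set 'I_p2} :=
  [set i | (calG w xi 0 i == 0) && (xi 0 i == 0)].

Definition mcs_matrix w xi (I : {set 'I_p2}) :
    'M[R]_(q + (#|Iplus w xi :|: I| + #|Iminus w xi :|: (Izero w xi :\: I)|),
           p1 + p2) :=
  let J := Iplus w xi :|: I in
  let K := Iminus w xi :|: (Izero w xi :\: I) in
  col_mx (row_mx (Jac (fun w' => calH w' xi) w) (Jac (fun xi' => calH w xi') xi))
 (col_mx (row_mx (rows J (Jac (fun w' => calG w' xi) w))
                 (rows J (Jac (fun xi' => calG w xi') xi)))
         (row_mx 0 (- rows K 1%:M))).

End MixedComplementarity.

(* Main.v *)
(* Let (dw, dxi), dxi = (dmu, dnu, dnuh), be in the kernel of the matrix.  In
   every index either dxi or the derivative of the constraint along dw vanishes,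
   so pairing the first block row with dw leaves only the quadratic form of the
   Hessian of the Lagrangian; as dw is critical, dw = 0 by the second-order
   condition.  BLICQ then gives dmu = 0 and dnu = lambda dnuh, and LLICQ applied
   to the second block row gives dnuh = 0. *)
Require Import Defs.
From mathcomp Require Import all_boot all_order all_algebra.
From mathcomp Require Import all_classical all_reals all_analysis.
Import numFieldNormedType.Exports.
Import Order.TTheory GRing.Theory Num.Theory.

Set Implicit Arguments.
Unset Strict Implicit.
Unset Printing Implicit Defensive.

Local Open Scope ring_scope.

(** * Linear independence of families indexed by finite sets *)

Section FreeFamilies.
Variables (K : fieldType) (V : vectType K).

(** Coefficients live on all of [I] and vanish off [A], so that a multiplier vector can serve as a
    coefficient family without being reindexed along the enumeration of [A]. *)
Lemma free_enumP (I : finType) (A : {pred I}) (X : I -> V) :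
  reflect (forall c : I -> K, (forall i, i \notin A -> c i = 0) ->
             \sum_i c i *: X i = 0 -> forall i, c i = 0)
          (free [seq X i | i <- enum A]).
Proof.
have sumE (c : I -> K) : (forall i, i \notin A -> c i = 0) ->
    \sum_i c i *: X i = \sum_(k < #|A|) c (tnth (enum_tuple A) k) *:
                           [tuple of map X (enum_tuple A)]`_k.
  move=> cA; rewrite (bigID (mem A)) /= [X in _ + X]big1 ?addr0; last first.
    by move=> i iA; rewrite cA ?scale0r.
  rewrite -big_enum big_tuple; apply: eq_bigr => k _.
  by rewrite -tnth_nth tnth_map.
set T : #|A|.-tuple V := [tuple of map X (enum_tuple A)].
rewrite -[map _ _]/(tval T).
apply: (iffP (@freeP _ _ _ T)) => [freeX c cA|freeX k].
  rewrite sumE // => /freeX c0 i.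
  have [iA|/cA//] := boolP (i \in A).
  have : i \in enum_tuple A by rewrite mem_enum.
  by case/tnthP => k ->.
have kE (i : 'I_#|A|) : tnth (enum_tuple A) i = enum_val i.
  by rewrite (tnth_nth (enum_default i)).
(* [k] is indexed by positions in the enumeration of [A], and [c] transports it to [I]. The
   enumeration is injective, so at most one [j] contributes to each [c i], and none does when [i] is
   outside [A]. *)
pose c i := \sum_(j < #|A| | tnth (enum_tuple A) j == i) k j.
have ck j : c (tnth (enum_tuple A) j) = k j.
  by rewrite /c (big_pred1 j) // => j'; rewrite !kE (inj_eq enum_val_inj).
have cA i : i \notin A -> c i = 0.
  move=> iA; apply: big1 => j /eqP ji.
  by case/negP: iA; rewrite -ji kE enum_valP.
move=> sum0 j; rewrite -ck; apply: freeX => //.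
by rewrite sumE // -[RHS]sum0; apply: eq_bigr => i _; rewrite ck.
Qed.

Lemma free_cat_enum (I J : finType) (A : {pred I}) (B : {pred J})
    (X : I -> V) (Y : J -> V) (c : I -> K) (d : J -> K) :
  free ([seq X i | i <- enum A] ++ [seq Y j | j <- enum B]) ->
  (forall i, i \notin A -> c i = 0) -> (forall j, j \notin B -> d j = 0) ->
  \sum_i c i *: X i + \sum_j d j *: Y j = 0 ->
  (forall i, c i = 0) /\ (forall j, d j = 0).
Proof.
rewrite cat_free => /and3P[/free_enumP freeX /free_enumP freeY /directv_addP XY0].
move=> cA dB sum0.
have inspan (H : finType) (C : {pred H}) (Z : H -> V) (e : H -> K) :
    (forall i, i \notin C -> e i = 0) ->
    \sum_i e i *: Z i \in <<[seq Z i | i <- enum C]>>%VS.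
  move=> eC; apply: rpred_sum => i _.
  have [iC|/eC->] := boolP (i \in C); last by rewrite scale0r rpred0.
  by apply/rpredZ/memv_span/map_f; rewrite mem_enum.
(* This sum is the negative of the one over [Y], hence lies in both spans, which meet only in 0. *)
have sumX0 : \sum_i c i *: X i = 0.
  apply/eqP; rewrite -memv0 -XY0 memv_cap inspan //=.
  by move/eqP: sum0; rewrite addr_eq0 => /eqP ->; rewrite rpredN inspan.
by split; [apply: freeX | apply: freeY; rewrite // -[RHS]sum0 sumX0 add0r].
Qed.

End FreeFamilies.

(** The product [A *m v^T] is the combination of the columns of [A] with weights [v]. *)
Lemma independent_columnsP (R : realType) p q (A : 'M[R]_(p, q)) :
  (forall v : 'rV[R]_q, A *m v^T = 0 -> v = 0) -> independent_columns A.
Proof.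
move=> ker0; apply/free_enumP => c _ sum0 j.
have /ker0/rowP/(_ j) : A *m (\row_j c j)^T = 0.
  rewrite -[RHS]sum0; apply/colP => i; rewrite mxE summxE.
  by apply: eq_bigr => k _; rewrite !mxE mulrC.
by rewrite !mxE.
Qed.

Lemma rows_mulmx0 (R : realType) p q r (I : {set 'I_p}) (A : 'M[R]_(p, q))
    (B : 'M[R]_(q, r)) :
  rows I A *m B = 0 -> forall i, i \in I -> row i A *m B = 0.
Proof.
move=> IAB0 i iI; have /(congr1 (row (enum_rank_in iI i))) := IAB0.
by rewrite row_mul row_rowsub enum_rankK_in // row0.
Qed.

(** * Jacobians and gradients *)

Section Calculus.
Variable R : realType.
Implicit Types k l : nat.

(** [h] is the finite sum of its components times the basis vectors. *)
Lemma differentiable_rV (V : normedModType R) l (h : V -> 'rV[R]_l) a :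
  (forall i, differentiable (fun x => h x 0 i) a) -> differentiable h a.
Proof.
move=> dh.
have -> : h = \sum_(i < l) (fun x => h x 0 i *: delta_mx 0 i : 'rV[R]_l).
  by apply/funext => x; rewrite fct_sumE [LHS]row_sum_delta.
by apply: differentiable_sum => i; exact: (differentiableZl _ (dh i)).
Qed.

Lemma differentiable_component k l (h : 'rV[R]_k -> 'rV[R]_l) a i :
  differentiable h a -> differentiable (component h i) a.
Proof.
by move=> dh; exact: (differentiable_comp dh (differentiable_coord _ _ _)).
Qed.

(** Links the differential, which underlies [Jac], to the directional derivatives, which make up
    [gradient]. *)
Lemma row_Jac k l (h : 'rV[R]_k -> 'rV[R]_l) a i :
  differentiable h a -> row i (Jac h a) = gradient (component h i) a.
Proof.
move=> dh; apply/rowP => j; rewrite !mxE -deriveE // derive_mx ?mxE //.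
exact: diff_derivable.
Qed.

Lemma mulmx_Jac k l (h : 'rV[R]_k -> 'rV[R]_l) a (eta : 'rV[R]_l) :
  differentiable h a ->
  eta *m Jac h a = \sum_i eta 0 i *: gradient (component h i) a.
Proof.
by move=> dh; rewrite mulmx_sum_row; apply: eq_bigr => i _; rewrite row_Jac.
Qed.

Lemma differentiable_row_mx (V : normedModType R) l1 l2 (h1 : V -> 'rV[R]_l1)
    (h2 : V -> 'rV[R]_l2) a :
  differentiable h1 a -> differentiable h2 a ->
  differentiable (fun x => row_mx (h1 x) (h2 x)) a.
Proof.
move=> d1 d2; apply: differentiable_rV => i; case: (split_ordP i) => j ->.
  under eq_fun do rewrite row_mxEl.
  exact: (differentiable_comp d1 (differentiable_coord _ _ _)).
under eq_fun do rewrite row_mxEr.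
exact: (differentiable_comp d2 (differentiable_coord _ _ _)).
Qed.

Lemma Jac_row_mx k l1 l2 (h1 : 'rV[R]_k -> 'rV[R]_l1)
    (h2 : 'rV[R]_k -> 'rV[R]_l2) a :
  differentiable h1 a -> differentiable h2 a ->
  Jac (fun x => row_mx (h1 x) (h2 x)) a = col_mx (Jac h1 a) (Jac h2 a).
Proof.
move=> d1 d2; apply/row_matrixP => i; rewrite row_Jac; last first.
  exact: differentiable_row_mx.
case: (split_ordP i) => j ->.
  rewrite rowKu row_Jac //; congr gradient.
  by apply/funext => x; rewrite /component row_mxEl.
rewrite rowKd row_Jac //; congr gradient.
by apply/funext => x; rewrite /component row_mxEr.
Qed.

(** [Lop] and [lop] are built from sums of this shape; written as a sum of scaled functions, they
    are open to the rules for derivatives of sums and multiples. *)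
Lemma add_dotE k l (h0 : 'rV[R]_k -> R) (h : 'rV[R]_k -> 'rV[R]_l) eta :
  (fun x => h0 x + dot eta (h x)) = h0 + \sum_i eta 0 i *: component h i.
Proof.
apply/funext => x; rewrite /dot mxE -[RHS]/(h0 x + _) fct_sumE; congr (_ + _).
by apply: eq_bigr => i _; rewrite mxE.
Qed.

Lemma differentiable_add_dot k l (h0 : 'rV[R]_k -> R)
    (h : 'rV[R]_k -> 'rV[R]_l) eta a :
  differentiable h0 a -> differentiable h a ->
  differentiable (fun x => h0 x + dot eta (h x)) a.
Proof.
move=> d0 dh; rewrite add_dotE; apply: differentiableD => //.
apply: differentiable_sum => i; apply: differentiableZ.
exact: differentiable_component.
Qed.

Lemma gradient_add_dot k l (h0 : 'rV[R]_k -> R)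
    (h : 'rV[R]_k -> 'rV[R]_l) eta a :
  differentiable h0 a -> differentiable h a ->
  gradient (fun x => h0 x + dot eta (h x)) a = gradient h0 a + eta *m Jac h a.
Proof.
move=> d0 dh; have dc i := diff_derivable (differentiable_component i dh).
rewrite mulmx_Jac // add_dotE; apply/rowP => j; rewrite !mxE.
rewrite deriveD; last 2 first.
- exact: diff_derivable.
- by apply: derivable_sum => i; apply: derivableZ; apply: dc.
congr (_ + _); rewrite derive_sum; last by move=> i; apply: derivableZ; apply: dc.
rewrite summxE; apply: eq_bigr => i _.
by rewrite deriveZ ?mxE //; apply: dc.
Qed.

Lemma Jac_id k (a : 'rV[R]_k) : Jac id a = 1%:M.
Proof.
rewrite -trmx1; congr trmx; apply/row_matrixP => i.
by rewrite !rowE mul_rV_lin1 -deriveE // derive_id mulmx1.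
Qed.

(** Brings each component into the shape handled by [gradient_add_dot], with a constant for [h0] and
    the identity for [h]. *)
Lemma affine_component k l (c : 'rV[R]_l) (A : 'M[R]_(k, l)) i :
  component (fun x => c + x *m A) i = fun x => c 0 i + dot (col i A)^T x.
Proof.
apply/funext => x; rewrite /component /dot !mxE; congr (_ + _).
by apply: eq_bigr => j _; rewrite !mxE mulrC.
Qed.

Lemma Jac_affine k l (c : 'rV[R]_l) (A : 'M[R]_(k, l)) a :
  Jac (fun x => c + x *m A) a = A^T.
Proof.
have dcst i : differentiable (fun=> c 0 i : R) a by exact: differentiable_cst.
have did : differentiable (fun x : 'rV[R]_k => x) a by [].
apply/row_matrixP => i; rewrite row_Jac; last first.
  apply: differentiable_rV => j.
  rewrite -/(component _ j) affine_component.
  exact: (differentiable_add_dot _ (dcst j) did).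
rewrite affine_component (gradient_add_dot _ (dcst i) did) Jac_id mulmx1.
rewrite -tr_col [gradient _ _](_ : _ = 0) ?add0r //.
by apply/rowP => j; rewrite !mxE derive_cst.
Qed.

Lemma Jac_cst k l (c : 'rV[R]_l) (a : 'rV[R]_k) : Jac (fun=> c) a = 0.
Proof.
rewrite -[RHS]trmx0 -(Jac_affine c 0 a); congr Jac.
by apply/funext => x; rewrite mulmx0 addr0.
Qed.

(** The difference quotients coincide: moving [y] by [r *: v] moves [row_mx x y] by
    [r *: row_mx 0 v]. *)
Lemma derive_slice (V : normedModType R) n m (h : 'rV[R]_(n + m) -> V) x y v :
  'D_v (fun y => h (row_mx x y)) y = 'D_(row_mx 0 v) h (row_mx x y).
Proof.
have shiftE r : r *: row_mx 0 v + row_mx x y = row_mx x (r *: v + y).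
  by rewrite scale_row_mx scaler0 add_row_mx add0r.
by rewrite /derive /=; under [in RHS]eq_fun do rewrite shiftE.
Qed.

Lemma gradient_yE n m (h : 'rV[R]_(n + m) -> R) w :
  gradient_y h w = rsubmx (gradient h w).
Proof.
apply/rowP => j; rewrite !mxE derive_slice hsubmxK; congr derive.
(* The [j]-th basis vector padded with zeros on the left is the basis vector of index
   [rshift n j]. *)
by apply/rowP => i; rewrite !mxE; case: split_ordP => i' ->;
  rewrite !mxE !eqxx ?eq_lrshift ?eq_rshift.
Qed.

End Calculus.

Lemma dotC (R : realType) k (u v : 'rV[R]_k) : dot u v = dot v u.
Proof. by rewrite /dot !mxE; apply: eq_bigr => i _; rewrite !mxE mulrC. Qed.

Lemma dot_row_mx (R : realType) k l (u1 v1 : 'rV[R]_k) (u2 v2 : 'rV[R]_l) :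
  dot (row_mx u1 u2) (row_mx v1 v2) = dot u1 v1 + dot u2 v2.
Proof. by rewrite /dot tr_row_mx mul_row_col mxE. Qed.

(** The product is the sum of the [u 0 i *: (row i A *m y)], and each term has a zero factor. *)
Lemma mulmx_complementary_rows (K : fieldType) p q (u : 'rV[K]_p)
    (A : 'M[K]_(p, q)) (y : 'cV[K]_q) :
  (forall i, u 0 i = 0 \/ row i A *m y = 0) -> u *m A *m y = 0.
Proof.
move=> uAy; rewrite (mulmx_sum_row u) mulmx_suml big1 // => i _.
by rewrite -scalemxAl; case: (uAy i) => ->; rewrite ?scale0r ?scaler0.
Qed.

(** * Differentiability of maps built from C2 data *)

Section C2Maps.
Variable R : realType.
Implicit Types k l n m : nat.

Lemma C2_vec_differentiable k l (h : 'rV[R]_k -> 'rV[R]_l) a :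
  C2_vec h -> differentiable h a.
Proof.
by move=> h2; apply: differentiable_rV => i; exact: (proj1 (h2 i)).
Qed.

Lemma C2_gradient_differentiable k (h : 'rV[R]_k -> R) a :
  C2 h -> differentiable (gradient h) a.
Proof. by case=> _ [dh _]; exact: dh. Qed.

(** For fixed [eta] this is a linear combination of the gradients of the components, each of which
    is differentiable. *)
Lemma differentiable_mulmx_Jac k l (h : 'rV[R]_k -> 'rV[R]_l)
    (eta : 'rV[R]_l) a :
  C2_vec h -> differentiable (fun x => eta *m Jac h x) a.
Proof.
move=> h2.
have -> : (fun x => eta *m Jac h x) =
    \sum_i eta 0 i *: gradient (component h i).
  apply/funext => x; rewrite fct_sumE mulmx_Jac //.
  exact: C2_vec_differentiable.
apply: differentiable_sum => i; apply: differentiableZ.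
exact: C2_gradient_differentiable (h2 i).
Qed.

Lemma differentiable_slice (V : normedModType R) n m
    (h : 'rV[R]_(n + m) -> V) x y :
  differentiable h (row_mx x y) -> differentiable (fun y => h (row_mx x y)) y.
Proof.
move=> dh; apply: (@differentiable_comp _ _ _ _ (row_mx x) h) => //.
apply: differentiable_row_mx => //; exact: differentiable_cst.
Qed.

Lemma row_Jac_y n m l (h : 'rV[R]_(n + m) -> 'rV[R]_l) w i :
  differentiable h w -> row i (Jac_y h w) = gradient_y (component h i) w.
Proof.
by move=> dh; rewrite row_Jac //; apply: differentiable_slice; rewrite hsubmxK.
Qed.

End C2Maps.

(** * The system [calH], [calG] and the kernel of its matrix *)

Section StationaritySystem.
Variables (R : realType) (n m s t : nat).
Variables (F f : 'rV[R]_(n + m) -> R).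
Variables (G : 'rV[R]_(n + m) -> 'rV[R]_s) (g : 'rV[R]_(n + m) -> 'rV[R]_t).
Variable lambda : R.
Hypotheses (F2 : C2 F) (f2 : C2 f) (G2 : C2_vec G) (g2 : C2_vec g).
Implicit Types (w : 'rV[R]_(n + m)) (xi : 'rV[R]_(s + (t + t))).

Let dF w : differentiable F w. Proof. exact: (proj1 F2). Qed.
Let df w : differentiable f w. Proof. exact: (proj1 f2). Qed.
Let dG w : differentiable G w. Proof. exact: C2_vec_differentiable. Qed.
Let dg w : differentiable g w. Proof. exact: C2_vec_differentiable. Qed.

Lemma gradient_Lop w xi :
  gradient (fun w' => Lop F G g lambda w' xi) w =
  gradient F w + mu_of xi *m Jac G w
    + (nu_of xi - lambda *: nuh_of xi) *m Jac g w.
Proof.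
rewrite (gradient_add_dot _ _ (dg w)); last exact: differentiable_add_dot.
by rewrite gradient_add_dot.
Qed.

Lemma gradient_y_lop w xi :
  gradient_y (fun w' => lop f g w' xi) w =
  gradient_y f w + nuh_of xi *m Jac_y g w.
Proof.
by rewrite [LHS]gradient_add_dot //; apply: differentiable_slice;
   rewrite hsubmxK.
Qed.

(** For fixed [w] the map is affine in [xi], so its Jacobian in [xi] is the transpose of this
    coefficient matrix. The entry with [lambda] stems from the multiplier [nu - lambda nuh] in
    [Lop]. *)
Lemma calH_affine w xi :
  calH F f G g lambda w xi =
  row_mx (gradient F w) (gradient_y f w) +
  xi *m row_mx (col_mx (Jac G w) (col_mx (Jac g w) (- (lambda *: Jac g w))))
               (col_mx 0 (col_mx 0 (Jac_y g w))).
Proof.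
have xiE : xi = row_mx (mu_of xi) (row_mx (nu_of xi) (nuh_of xi)).
  by rewrite !hsubmxK.
rewrite /calH gradient_Lop gradient_y_lop [X in X *m row_mx _ _]xiE.
rewrite mul_mx_row !mul_row_col !mulmx0 !add0r add_row_mx.
by rewrite mulmxBl mulmxN -scalemxAl -scalemxAr !addrA.
Qed.

(** The lower block [B] stays anonymous: the second block row is only exploited once [dw = 0] is
    known, when [B] drops out. *)
Lemma Jac_calH_w w xi :
  exists B, Jac (fun w' => calH F f G g lambda w' xi) w =
            col_mx (hessian (fun w' => Lop F G g lambda w' xi) w) B.
Proof.
have dL : differentiable (gradient (fun w' => Lop F G g lambda w' xi)) w.
  rewrite (funext (gradient_Lop^~ xi)).
  apply: differentiableD; last exact: differentiable_mulmx_Jac.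
  apply: differentiableD; last exact: differentiable_mulmx_Jac.
  exact: C2_gradient_differentiable.
have dl : differentiable (gradient_y (fun w' => lop f g w' xi)) w.
  (* As the right part of a full gradient, the partial gradient inherits its differentiability. *)
  have gradE w' : gradient_y (fun w0 => lop f g w0 xi) w' =
      rsubmx (gradient f w' + nuh_of xi *m Jac g w').
    by rewrite gradient_yE gradient_add_dot.
  rewrite (funext gradE).
  apply: (@differentiable_comp _ _ _ _ _ rsubmx); last exact: differentiable_rsubmx.
  apply: differentiableD; last exact: differentiable_mulmx_Jac.
  exact: C2_gradient_differentiable.
by eexists; rewrite [LHS](Jac_row_mx dL dl).
Qed.

Lemma Jac_calG_w w xi :
  Jac (fun w' => calG G g w' xi) w = col_mx (Jac G w) (col_mx (Jac g w) (Jac g w)).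
Proof. by rewrite [LHS]Jac_row_mx ?Jac_row_mx //; exact: differentiable_row_mx. Qed.

Lemma stationary_mcs_solution w xi :
  stationary F f G g lambda w xi ->
  mcs_solution (calG G g) (calH F f G g lambda) w xi.
Proof.
move=> [Lw0 lw0 [mu0 G0 muG0] [nu0 g0 nug0] [nuh0 _ nuhg0]].
have xiE : xi = row_mx (mu_of xi) (row_mx (nu_of xi) (nuh_of xi)).
  by rewrite !hsubmxK.
split.
- by rewrite /calH gradient_Lop gradient_y_lop Lw0 lw0 row_mx0.
- move=> i; rewrite /calG; case: (split_ordP i) => j ->; first by rewrite row_mxEl.
  by rewrite row_mxEr; case: (split_ordP j) => k ->; rewrite ?row_mxEl ?row_mxEr.
- move=> i; rewrite xiE; case: (split_ordP i) => j ->; first by rewrite row_mxEl.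
  by rewrite row_mxEr; case: (split_ordP j) => k ->; rewrite ?row_mxEl ?row_mxEr.
- by rewrite dotC xiE /calG !dot_row_mx muG0 nug0 nuhg0 !addr0.
Qed.

(** Reads the kernel equation block by block. The first equation keeps the transposes of the
    row-vector convention, and the second is stated under [dw = 0] because of the anonymous
    block. *)
Lemma kernel_mcs_matrix w xi (I : {set 'I_(s + (t + t))}) dw dxi :
  mcs_matrix (calG G g) (calH F f G g lambda) w xi I *m (row_mx dw dxi)^T = 0 ->
  [/\ hessian (fun w' => Lop F G g lambda w' xi) w *m dw^T +
        (mu_of dxi *m Jac G w
          + (nu_of dxi - lambda *: nuh_of dxi) *m Jac g w)^T = 0,
     dw = 0 -> nuh_of dxi *m Jac_y g w = 0,
     forall i, i \in Iplus (calG G g) w xi :|: I ->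
       row i (col_mx (Jac G w) (col_mx (Jac g w) (Jac g w))) *m dw^T = 0 &
     forall i, i \in Iminus (calG G g) w xi :|: (Izero (calG G g) w xi :\: I) ->
       dxi 0 i = 0].
Proof.
have [B JHw] := Jac_calH_w w xi.
(* [calG] does not depend on [xi]. *)
have JGxi : Jac (fun xi' => calG G g w xi') xi = 0 by exact: Jac_cst.
have dxiE : dxi = row_mx (mu_of dxi) (row_mx (nu_of dxi) (nuh_of dxi)).
  by rewrite !hsubmxK.
rewrite /mcs_matrix JHw Jac_calG_w JGxi (eq_fun (calH_affine w)) Jac_affine.
rewrite tr_row_mx tr_row_mx !mul_col_mx !mul_row_col => /eqP.
rewrite mul_col_mx [X in _ + X]mul_col_mx add_col_mx !col_mx_eq0.
rewrite -!trmx_mul mul0mx add0r mulNmx oppr_eq0.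
move=> /andP[/andP[/eqP HL /eqP Hl] /andP[/eqP HJ /eqP HK]].
rewrite dxiE !mul_row_col !mulmx0 !add0r in HL Hl.
split.
- by rewrite -[RHS]HL mulmxBl mulmxN -scalemxAl -scalemxAr.
- move=> dw0; move: Hl; rewrite dw0 trmx0 mulmx0 add0r => Hl.
  by apply: trmx_inj; rewrite Hl trmx0.
- apply: rows_mulmx0; rewrite -[RHS]HJ.
  rewrite [X in _ = _ + X *m _](_ : _ = 0) ?mul0mx ?addr0 //.
  by apply/matrixP => i j; rewrite !mxE.
- move=> i iK; have := rows_mulmx0 HK iK.
  by rewrite row1 -rowE => /rowP/(_ 0); rewrite !mxE.
Qed.

End StationaritySystem.

(** * Triviality of the kernel *)

Theorem theorem5p3 (R : realType) (n m s t : nat)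
    (F f : 'rV[R]_(n + m) -> R)
    (G : 'rV[R]_(n + m) -> 'rV[R]_s) (g : 'rV[R]_(n + m) -> 'rV[R]_t)
    (lambda : R) (w : 'rV[R]_(n + m)) (xi : 'rV[R]_(s + (t + t))) :
  C2 F -> C2 f -> C2_vec G -> C2_vec g ->
  0 < lambda ->
  stationary F f G g lambda w xi ->
  LLICQ g w ->
  BLICQ G g w ->
  second_order_condition F G g lambda w xi ->
  mcs_solution (calG G g) (calH F f G g lambda) w xi /\
  forall I : {set 'I_(s + (t + t))},
    I \subset Izero (calG G g) w xi ->
    independent_columns
      (mcs_matrix (calG G g) (calH F f G g lambda) w xi I).
Proof.
move=> F2 f2 G2 g2 lambda_gt0 stat llicq blicq soc.
have sol := stationary_mcs_solution F2 f2 G2 g2 stat.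
split=> // I sub_I; apply: independent_columnsP => v.
rewrite -[v]hsubmxK; move: (lsubmx v) (rsubmx v) => dw dxi.
move=> /(kernel_mcs_matrix F2 f2 G2 g2)[HL Hl HJ HK].
have [_ G_le0 xi_ge0 _] := sol.
(* Every index lies in [Iminus], [Iplus], [I] or [Izero :\: I]; the first and last force
   [dxi 0 i = 0], the other two annihilate the constraint derivative along [dw]. *)
have compl i : dxi 0 i = 0 \/
    row i (col_mx (Jac G w) (col_mx (Jac g w) (Jac g w))) *m dw^T = 0.
  have [Gi0|Gi_neq0] := eqVneq (calG G g w xi 0 i) 0; last first.
    by left; apply: HK; rewrite !inE lt_neqAle Gi_neq0 G_le0.
  have [iI|iI] := boolP (i \in I); first by right; apply: HJ; rewrite inE iI orbT.
  have [xi0|xi_neq0] := eqVneq (xi 0 i) 0.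
    by left; apply: HK; rewrite !inE iI Gi0 xi0 eqxx orbT.
  by right; apply: HJ; rewrite !inE Gi0 eqxx lt_neqAle eq_sym xi_neq0 xi_ge0.
have complG i : mu_of dxi 0 i = 0 \/ row i (Jac G w) *m dw^T = 0.
  by have := compl (lshift _ i); rewrite rowKu mxE.
have complg i : nu_of dxi 0 i = 0 \/ row i (Jac g w) *m dw^T = 0.
  by have := compl (rshift _ (lshift _ i)); rewrite rowKd rowKu !mxE.
have complgh i : nuh_of dxi 0 i = 0 \/ row i (Jac g w) *m dw^T = 0.
  by have := compl (rshift _ (rshift _ i)); rewrite !rowKd !mxE.
(* Active indices with a positive multiplier belong to [Iplus]. The two copies of [g] in [calG] take
   care of [nu] and [nuh] separately, which covers the union in the critical subspace. *)
have dw_crit : critical_subspace G g w xi dw.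
  split=> i; rewrite !inE.
    move=> /andP[Gi0 mui]; have := HJ (lshift _ i); rewrite rowKu; apply.
    by rewrite !inE row_mxEl Gi0; rewrite mxE in mui; rewrite mui.
  case/orP=> /andP[gi0 nui].
    have := HJ (rshift _ (lshift _ i)); rewrite rowKd rowKu; apply.
    by rewrite !inE row_mxEr row_mxEl gi0; rewrite !mxE in nui; rewrite nui.
  have := HJ (rshift _ (rshift _ i)); rewrite !rowKd; apply.
  by rewrite !inE !row_mxEr gi0; rewrite !mxE in nui; rewrite nui.
set X := mu_of dxi *m Jac G w + (nu_of dxi - lambda *: nuh_of dxi) *m Jac g w.
rewrite -/X in HL.
(* Each of the three products vanishes by complementarity, so pairing [HL] with [dw] leaves the
   quadratic form alone. *)
have Xdw : X *m dw^T = 0.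
  rewrite mulmxDl !mulmxBl -!scalemxAl !(mulmx_complementary_rows, scaler0) //.
  by rewrite subr0 addr0.
have quad0 : dw *m hessian (fun w' => Lop F G g lambda w' xi) w *m dw^T = 0.
  have := congr1 (mulmx dw) HL; rewrite mulmxDr mulmx0 mulmxA => <-.
  by rewrite -[X in _ = _ + X]trmxK trmx_mul trmxK Xdw trmx0 addr0.
have dw0 : dw = 0.
  apply/eqP/negP => /negP /(soc _ dw_crit).
  by rewrite /dot quad0 mxE ltxx.
have X0 : X = 0.
  by apply: trmx_inj; rewrite trmx0 -[RHS]HL dw0 trmx0 mulmx0 add0r.
have dG := C2_vec_differentiable w G2; have dg := C2_vec_differentiable w g2.
(* Inactive indices are in [Iminus]; this confines the coefficients to the active gradients, as the
   constraint qualifications require. *)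
have inactiveG i : i \notin active G w -> mu_of dxi 0 i = 0.
  rewrite inE => Gi; rewrite mxE; apply: HK.
  have := G_le0 (lshift _ i).
  by rewrite !inE row_mxEl le_eqVlt (negPf Gi) /= => ->.
have inactiveg i : i \notin active g w ->
    nu_of dxi 0 i = 0 /\ nuh_of dxi 0 i = 0.
  rewrite inE => gi; rewrite !mxE; split; apply: HK.
    have := G_le0 (rshift _ (lshift _ i)).
    by rewrite !inE row_mxEr row_mxEl le_eqVlt (negPf gi) /= => ->.
  have := G_le0 (rshift _ (rshift _ i)).
  by rewrite !inE !row_mxEr le_eqVlt (negPf gi) /= => ->.
(* LLICQ is used first: with [dw = 0] the second block row is a vanishing combination of the active
   gradients in [y]. *)
have nuh0 : nuh_of dxi = 0.
  apply/rowP => i; rewrite [RHS]mxE; move: i.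
  apply: (elimT (free_enumP _ _) llicq) => [i /inactiveg[]//|].
  rewrite -[RHS](Hl dw0) mulmx_sum_row.
  by apply: eq_bigr => i _; rewrite row_Jac_y.
(* [X = 0] is a vanishing combination of the full active gradients with coefficients [dmu] and
   [dnu - lambda dnuh], so BLICQ applies. *)
have [mu0 nu0] : (forall i, mu_of dxi 0 i = 0) /\
    (forall i, (nu_of dxi - lambda *: nuh_of dxi) 0 i = 0).
  apply: (free_cat_enum blicq inactiveG).
    move=> i /inactiveg[nui nuhi].
    by rewrite nuh0 scaler0 subr0.
  by rewrite -[RHS]X0 /X !mulmx_Jac.
have -> : dxi = row_mx (mu_of dxi) (row_mx (nu_of dxi) (nuh_of dxi)).
  by rewrite !hsubmxK.
have -> : mu_of dxi = 0 by apply/rowP => i; rewrite mu0 mxE.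
have -> : nu_of dxi = 0.
  by apply/rowP => i; rewrite [RHS]mxE -[RHS](nu0 i) nuh0 scaler0 subr0.
by rewrite dw0 nuh0 !row_mx0.
Qed.
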